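(* Consider the Lie-Poisson structures $\pi_f=\pi_{0,f}$ on $\mathbb{R}^3$ with $f$ equal to (1) $0$; (2) $x^2+y^2+z^2$; (3) $x^2+y^2-z^2$; (4) $x^2+y^2$; (5) $x^2-y^2$; (6) $x^2$. A pair $(K,F)$ defines a quadratic deformation of the structure (i) if and only if $K$ has the corresponding form below, where $F$ may be any homogeneous cubic polynomial such that $\hat{K}F=0$: (1) $K\in\mathfrak{sl}(3)$; (2) $K\in\mathfrak{o}(3)$; (3) $K\in\mathfrak{o}(2,1)$; (4) $K=\begin{pmatrix}0&\alpha&0\\-\alpha&0&0\\\beta&\gamma&0\end{pmatrix}$; (5) $K=\begin{pmatrix}0&\alpha&0\\\alpha&0&0\\\beta&\gamma&0\end{pmatrix}$; (6) $K=\begin{pmatrix}0&0&0\\\alpha&\delta&\theta\\\beta&\gamma&-\delta\end{pmatrix}$, with $\alpha,\beta,\gamma,\delta,\theta\in\mathbb{R}$ arbitrary.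
   Context: All objects are real; $(x,y,z)=(x_1,x_2,x_3)$ are coordinates on $\mathbb{R}^3$. For a matrix $A=(a_{ij})$, $\hat{A}=\sum_{i,j}a_{ij}x_j\frac{\partial}{\partial x_i}$ ($I$ is the identity matrix). For a function $g$, $$\pi_g=\frac{\partial g}{\partial x}\frac{\partial}{\partial y}\wedge\frac{\partial}{\partial z}+\frac{\partial g}{\partial y}\frac{\partial}{\partial z}\wedge\frac{\partial}{\partial x}+\frac{\partial g}{\partial z}\frac{\partial}{\partial x}\wedge\frac{\partial}{\partial y}.$$ For $f$ a homogeneous quadratic polynomial, $\pi_{0,f}=\pi_f$ is a unimodular linear Poisson structure. Quadratic Poisson structures on $\mathbb{R}^3$ correspond to pairs $(K,F)$ with $K\in\mathfrak{sl}(3)$ and $F$ a homogeneous cubic polynomial with $\hat{K}F=0$, via $\pi_{K,F}=\frac13\hat{I}\wedge\hat{K}+\pi_F$. Such a pair defines a quadratic deformation of $\pi_{0,f}$ if $[\pi_{0,f},\pi_{K,F}]=0$ (Schouten bracket), i.e. if $\pi_{0,f}+\pi_{K,F}$ is Poisson. $\mathfrak{o}(3)$ and $\mathfrak{o}(2,1)$ are the Lie algebras of matrices infinitesimally preserving $x^2+y^2+z^2$ and $x^2+y^2-z^2$, respectively. *)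

(* Defs.v *)
From HB Require Import structures.
From mathcomp Require Import all_boot all_order all_algebra.
From mathcomp Require Import reals.
From mathcomp Require Import mpoly ring.

Set Implicit Arguments.
Unset Strict Implicit.
Unset Printing Implicit Defensive.

Import Order.TTheory GRing.Theory Num.Theory.
Local Open Scope ring_scope.

(* Polynomial multivector fields on R^3: every tensor involved in linear and
   quadratic Poisson structures on R^3 has polynomial coefficients. *)

Definition ix : 'I_3 := @Ordinal 3 0 isT.
Definition iy : 'I_3 := @Ordinal 3 1 isT.
Definition iz : 'I_3 := @Ordinal 3 2 isT.

Definition cx {R : realType} : {mpoly R[3]} := 'X_ix.
Definition cy {R : realType} : {mpoly R[3]} := 'X_iy.
Definition cz {R : realType} : {mpoly R[3]} := 'X_iz.

(* The column X stands for \sum_i X_i d/dx_i. *)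
Definition vfield (R : realType) := 'cV[{mpoly R[3]}]_3.

(* The matrix P, always antisymmetric below, stands for
   \sum_(i < j) P_ij d/dx_i /\ d/dx_j. *)
Definition bivector (R : realType) := 'M[{mpoly R[3]}]_3.

(* T stands for \sum_(i < j < k) T_ijk d/dx_i /\ d/dx_j /\ d/dx_k. *)
Definition trivector (R : realType) := 'I_3 -> 'I_3 -> 'I_3 -> {mpoly R[3]}.

Definition partial {R : realType} (i : 'I_3) : vfield R := delta_mx i 0.

Definition vf_app {R : realType} (X : vfield R) (g : {mpoly R[3]}) :
    {mpoly R[3]} :=
  \sum_i X i 0 * g^`M(i).

Definition wedge {R : realType} (X Y : vfield R) : bivector R :=
  \matrix_(i, j) (X i 0 * Y j 0 - X j 0 * Y i 0).

(* Schouten bracket of two bivector fields, in coordinates; see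
   schouten_wedge and schouten_jacobi below. *)
Definition schouten {R : realType} (P Q : bivector R) : trivector R :=
  fun i j k =>
    \sum_l (P i l * (Q j k)^`M(l) + Q i l * (P j k)^`M(l))
  + \sum_l (P j l * (Q k i)^`M(l) + Q j l * (P k i)^`M(l))
  + \sum_l (P k l * (Q i j)^`M(l) + Q k l * (P i j)^`M(l)).

Definition hat {R : realType} (A : 'M[R]_3) : vfield R :=
  \col_i \sum_j (A i j)%:MP * 'X_j.

Definition pi_fun {R : realType} (g : {mpoly R[3]}) : bivector R :=
    g^`M(ix) *: wedge (partial iy) (partial iz)
  + g^`M(iy) *: wedge (partial iz) (partial ix)
  + g^`M(iz) *: wedge (partial ix) (partial iy).

Definition pi_KF {R : realType} (K : 'M[R]_3) (F : {mpoly R[3]}) :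
    bivector R :=
  (3%:R^-1 : R)%:MP *: wedge (hat 1%:M) (hat K) + pi_fun F.

Definition in_sl3 {R : realType} (K : 'M[R]_3) : Prop := \tr K = 0.

(* The zero polynomial counts as homogeneous of degree 3. *)
Definition cubic_invariant {R : realType} (K : 'M[R]_3) (F : {mpoly R[3]}) :
    Prop :=
  F \is 3.-homog /\ vf_app (hat K) F = 0.

Definition quadratic_deformation {R : realType} (f : {mpoly R[3]})
    (K : 'M[R]_3) (F : {mpoly R[3]}) : Prop :=
  [/\ in_sl3 K, cubic_invariant K F &
      forall i j k, schouten (pi_fun f) (pi_KF K F) i j k = 0].

(* A linear vector field preserves q infinitesimally when it annihilates q. *)
Definition in_o {R : realType} (q : {mpoly R[3]}) (A : 'M[R]_3) : Prop :=
  vf_app (hat A) q = 0.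

Definition in_o3 {R : realType} (A : 'M[R]_3) : Prop :=
  in_o (cx ^+ 2 + cy ^+ 2 + cz ^+ 2) A.

Definition in_o21 {R : realType} (A : 'M[R]_3) : Prop :=
  in_o (cx ^+ 2 + cy ^+ 2 - cz ^+ 2) A.

Definition mx3 {R : realType} (rows : seq (seq R)) : 'M[R]_3 :=
  \matrix_(i, j) nth 0 (nth [::] rows i) j.

Definition lie_bracket {R : realType} (X Y : vfield R) : vfield R :=
  \col_i (vf_app X (Y i 0) - vf_app Y (X i 0)).

Definition wedge3 {R : realType} (X Y Z : vfield R) : trivector R :=
  fun i j k =>
    X i 0 * (Y j 0 * Z k 0 - Y k 0 * Z j 0)
  + X j 0 * (Y k 0 * Z i 0 - Y i 0 * Z k 0)
  + X k 0 * (Y i 0 * Z j 0 - Y j 0 * Z i 0).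

Lemma sum3 (V : nmodType) (F : 'I_3 -> V) : \sum_i F i = F ix + F iy + F iz.
Proof.
rewrite !big_ord_recl big_ord0 addr0 addrA.
by congr (F _ + F _ + F _); apply: val_inj.
Qed.

Lemma schouten_wedge (R : realType) (X Y Z W : vfield R) i j k :
  schouten (wedge X Y) (wedge Z W) i j k =
    wedge3 (lie_bracket X Z) Y W i j k - wedge3 (lie_bracket X W) Y Z i j k
  - wedge3 (lie_bracket Y Z) X W i j k + wedge3 (lie_bracket Y W) X Z i j k.
Proof.
rewrite /schouten /wedge3 /lie_bracket /vf_app !sum3 !mxE !sum3.
rewrite !(mderivB, mderivM).
ring.
Qed.

Definition poisson_bracket {R : realType} (P : bivector R)
    (g h : {mpoly R[3]}) : {mpoly R[3]} :=
  \sum_i \sum_j P i j * g^`M(i) * h^`M(j).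

Lemma mderivXU (R : realType) (i j : 'I_3) :
  ('X_i : {mpoly R[3]})^`M(j) = (i == j)%:R.
Proof.
rewrite mderivX mnmE; case: eqP => [->|_]; last by rewrite scale0r.
by rewrite scale1r -[X in (X - _)%MM]add0m addmK mpolyX0.
Qed.

Lemma poisson_bracketXl (R : realType) (P : bivector R) (i : 'I_3)
    (g : {mpoly R[3]}) :
  poisson_bracket P 'X_i g = \sum_l P i l * g^`M(l).
Proof.
rewrite /poisson_bracket (bigD1 i) //= [X in _ + X]big1 ?addr0.
  by apply: eq_bigr => l _; rewrite mderivXU eqxx mulr1.
move=> m mi; apply: big1 => l _.
by rewrite mderivXU eq_sym (negPf mi) mulr0 mul0r.
Qed.

Lemma poisson_bracketX (R : realType) (P : bivector R) (i j : 'I_3) :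
  poisson_bracket P 'X_i 'X_j = P i j.
Proof.
rewrite poisson_bracketXl (bigD1 j) //= big1 ?addr0.
  by rewrite mderivXU eqxx mulr1.
by move=> m mj; rewrite mderivXU eq_sym (negPf mj) mulr0.
Qed.

Definition jacobiator {R : realType} (P : bivector R)
    (g h k : {mpoly R[3]}) : {mpoly R[3]} :=
    poisson_bracket P g (poisson_bracket P h k)
  + poisson_bracket P h (poisson_bracket P k g)
  + poisson_bracket P k (poisson_bracket P g h).

Lemma mpoly_double_eq0 (R : realType) (p : {mpoly R[3]}) : p *+ 2 = 0 -> p = 0.
Proof.
move=> p0; apply/mpolyP => m; rewrite mcoeff0; apply/eqP.
by have /eqP := congr1 (mcoeff m) p0; rewrite mcoeffMn mcoeff0 mulrn_eq0.
Qed.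

Lemma schouten_jacobi (R : realType) (P : bivector R) (PN : P^T = - P) :
  (forall i j k, schouten P P i j k = 0) <->
  (forall g h k, jacobiator P g h k = 0).
Proof.
have PT i j : P j i = - P i j 
  by have := congr1 (fun M : bivector R => M i j) PN; rewrite !mxE.
split=> [S0 g h k | J0 i j k]; last first.
  have := J0 'X_i 'X_j 'X_k; rewrite /jacobiator !poisson_bracketX.
  rewrite !poisson_bracketXl /schouten => /(congr1 (fun p => p *+ 2)) /=.
  rewrite mul0rn !mulrnDl -!sumrMnl => J2; rewrite -[RHS]J2.
  by congr (_ + _ + _); apply: eq_bigr => l _; rewrite mulr2n.
have P0 i : P i i = 0.
  by apply: mpoly_double_eq0; rewrite mulr2n {1}PT addNr.
pose D (i : 'I_3) p : {mpoly R[3]} := p^`M(i).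
have DC i j p : D i (D j p) = D j (D i p) by exact: mderiv_comm.
have DA i p q : D i (p + q) = D i p + D i q by exact: mderivD.
have DN i p : D i (- p) = - D i p by exact: mderivN.
have DM i p q : D i (p * q) = D i p * q + p * D i q by exact: mderivM.
pose a := P ix iy; pose b := P iy iz; pose c := P iz ix.
have brE g1 g2 : poisson_bracket P g1 g2 =
    a * (D ix g1 * D iy g2 - D iy g1 * D ix g2)
  + b * (D iy g1 * D iz g2 - D iz g1 * D iy g2)
  + c * (D iz g1 * D ix g2 - D ix g1 * D iz g2).
  rewrite /poisson_bracket !sum3 !P0 (PT ix iy) (PT iy iz) (PT iz ix).
  rewrite -/a -/b -/c -!/(D _ _).
  move: (D ix g1) (D iy g1) (D iz g1) (D ix g2) (D iy g2) (D iz g2) => *.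
  ring.
have DbrE i g1 g2 : D i (poisson_bracket P g1 g2) =
    D i a * (D ix g1 * D iy g2 - D iy g1 * D ix g2)
  + a * (D i (D ix g1) * D iy g2 + D ix g1 * D i (D iy g2)
         - (D i (D iy g1) * D ix g2 + D iy g1 * D i (D ix g2)))
  + (D i b * (D iy g1 * D iz g2 - D iz g1 * D iy g2)
  + b * (D i (D iy g1) * D iz g2 + D iy g1 * D i (D iz g2)
         - (D i (D iz g1) * D iy g2 + D iz g1 * D i (D iy g2))))
  + (D i c * (D iz g1 * D ix g2 - D ix g1 * D iz g2)
  + c * (D i (D iz g1) * D ix g2 + D iz g1 * D i (D ix g2)
         - (D i (D ix g1) * D iz g2 + D ix g1 * D i (D iz g2)))).
  by rewrite brE !(DA, DN, DM).
have S123 : a * D iy b - c * D iz b + (b * D iz c - a * D ix c)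
    + (c * D ix a - b * D iy a) = 0.
  apply: mpoly_double_eq0; rewrite -[RHS](S0 ix iy iz) /schouten !sum3 !P0.
  rewrite (PT ix iy) (PT iy iz) (PT iz ix) -/a -/b -/c -!/(D _ _).
  move: (D iy b) (D iz b) (D iz c) (D ix c) (D ix a) (D iy a) => *.
  ring.
rewrite /jacobiator !(brE _ (poisson_bracket P _ _)) !DbrE.
rewrite !(DC iy ix, DC iz ix, DC iz iy).
transitivity ((a * D iy b - c * D iz b + (b * D iz c - a * D ix c)
    + (c * D ix a - b * D iy a)) *
   (D ix g * (D iy h * D iz k - D iz h * D iy k)
  + D iy g * (D iz h * D ix k - D ix h * D iz k)
  + D iz g * (D ix h * D iy k - D iy h * D ix k))); last by rewrite S123 mul0r.
move: (D ix (D ix g)) (D ix (D iy g)) (D ix (D iz g)) (D iy (D iy g))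
  (D iy (D iz g)) (D iz (D iz g)) => *.
move: (D ix (D ix h)) (D ix (D iy h)) (D ix (D iz h)) (D iy (D iy h))
  (D iy (D iz h)) (D iz (D iz h)) => *.
move: (D ix (D ix k)) (D ix (D iy k)) (D ix (D iz k)) (D iy (D iy k))
  (D iy (D iz k)) (D iz (D iz k)) => *.
move: (D ix g) (D iy g) (D iz g) (D ix h) (D iy h) (D iz h) => *.
move: (D ix k) (D iy k) (D iz k) (D ix a) (D iy a) (D iz a) => *.
move: (D ix b) (D iy b) (D iz b) (D ix c) (D iy c) (D iz c) => *.
move: a b c {brE DbrE S123} => *.
ring.
Qed.

Lemma in_oE (R : realType) (d : 'I_3 -> R) (A : 'M[R]_3) :
  in_o (\sum_i d i *: 'X_i ^+ 2) A <->
  A^T *m diag_mx (\row_i d i) + diag_mx (\row_i d i) *m A = 0.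
Proof. 
have E i j : (A^T *m diag_mx (\row_i d i) + diag_mx (\row_i d i) *m A) i j
    = A j i * d j + d i * A i j.
  by rewrite mul_diag_mx mul_mx_diag !mxE.
have appE : vf_app (hat A) (\sum_i d i *: 'X_i ^+ 2) =
    \sum_i \sum_j (2%:R * d i * A i j)%:MP * ('X_i * 'X_j).
  rewrite /vf_app; apply: eq_bigr => i _.
  rewrite raddf_sum /= (bigD1 i) //= [X in _ + X]big1 ?addr0.
    rewrite mxE mulr_suml; apply: eq_bigr => j _.
    rewrite mderivZ expr2 mderivM mderivXU eqxx -mul_mpolyC !mpolyCM mpolyC_nat.
    rewrite mul1r mulr1; ring.
  move=> m mi.
  by rewrite mderivZ expr2 mderivM mderivXU (negPf mi) mulr0 mul0r addr0 scaler0.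
rewrite /in_o appE; split=> [H | H].
  apply/matrixP => i j; rewrite E mxE.
  have dsum a (G : 'I_3 -> {mpoly R[3]}) :
    (\sum_k G k)^`M(a) = \sum_k (G k)^`M(a) by rewrite raddf_sum.
  have dterm k l (c : R) : ((c%:MP * ('X_k * 'X_l) : {mpoly R[3]})^`M(i))^`M(j) =
      (c * ((k == i)%:R * (l == j)%:R + (k == j)%:R * (l == i)%:R))%:MP.
    rewrite !mderiv_mulC mderivM !mderivXU mderivD !mderivM !mderivXU.
    rewrite -!mpolyC_nat !mderivC mul0r mulr0 add0r addr0.
    by rewrite -!mpolyCM -mpolyCD -mpolyCM.
  have Csum (G : 'I_3 -> R) :
    \sum_k ((G k)%:MP : {mpoly R[3]}) = (\sum_k G k)%:MP by rewrite raddf_sum.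
  have := congr1 (fun p : {mpoly R[3]} => (p^`M(i))^`M(j)) H.
  rewrite /= !mderiv0 !dsum.
  under eq_bigr => k _.
    rewrite !dsum; under eq_bigr do rewrite dterm.
    rewrite Csum; over.
  rewrite Csum => /eqP; rewrite mpolyC_eq0 => /eqP.
  under eq_bigr => k _ do under eq_bigr => l _ do rewrite mulrDr.
  under eq_bigr => k _ do rewrite big_split /=.
  rewrite big_split /=.
  have sumd (G : 'I_3 -> 'I_3 -> R) a b :
      \sum_k \sum_l G k l * ((k == a)%:R * (l == b)%:R) = G a b.
    rewrite (bigD1 a) //= [X in _ + X]big1 ?addr0; last first.
      by move=> k ka; apply: big1 => l _; rewrite (negPf ka) mul0r mulr0.
    rewrite (bigD1 b) //= big1 ?addr0 ?eqxx ?mulr1 //.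
    by move=> l lb; rewrite (negPf lb) !mulr0.
  rewrite !(sumd (fun k l => 2%:R * d k * A k l)) => D0.
  apply: (mulfI (_ : 2%:R != 0)); first by rewrite pnatr_eq0.
  by rewrite mulr0 -[RHS]D0; ring.
have S i j : d j * A j i = - (d i * A i j).
  have := congr1 (fun M : 'M_3 => M i j) H; rewrite E mxE => /eqP.
  by rewrite addr_eq0 [A j i * _]mulrC => /eqP.
apply: mpoly_double_eq0; rewrite mulr2n {2}exchange_big -big_split big1 //= => i _.
rewrite -big_split big1 //= => j _.
rewrite [_ * 'X_i]mulrC -mulrDl -mpolyCD -!mulrA -mulrDr [d j * _]S subrr.
by rewrite mulr0 mul0r.
Qed.

(* Main.v *)
Require Import Defs.
From HB Require Import structures.
From mathcomp Require Import all_boot all_order all_algebra.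
From mathcomp Require Import reals.
From mathcomp Require Import mpoly ring.

Set Implicit Arguments.
Unset Strict Implicit.
Unset Printing Implicit Defensive.

Import Order.TTheory GRing.Theory Num.Theory.
Local Open Scope ring_scope.

(** For an antisymmetric matrix [Q] put [div Q = \sum_j d_j Q_ji], a vector
    field.  Since [pi_fun f] is the contraction of the standard trivector with
    [df], the one independent component of its Schouten bracket with [Q] is the
    derivative of [f] along [div Q] ([schouten_pi_fun]).

    The divergence of [pi_fun F] is zero because mixed partials commute
    ([div_pi_fun]).  That of the wedge of the Euler field with [hat K] is
    [3 hat K] minus [tr K] times the Euler field ([div_wedge_hat]): the Euler
    field has divergence 3, and differentiating [hat K] along it and it along
    [hat K] gives two copies of [hat K] that cancel.  For traceless [K] the
    factor 1/3 thus makes [hat K] the divergence of [pi_KF K F] ([div_pi_KF]),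
    and [(K, F)] deforms [pi_fun f] exactly when [hat K] annihilates [f],
    for every cubic [F] invariant under [hat K] ([quadratic_deformationE]).

    Each [f] of the list is a diagonal form with coefficients [d_i], so the
    condition is the linear system [d_j K_ji + d_i K_ij = 0] ([in_o_diag]).
    When no [d_i] vanishes the system forces [tr K = 0] by itself; for the
    degenerate forms the trace condition constrains the diagonal entries that
    the system leaves free. *)

(** * The Schouten bracket of a unimodular structure with a bivector field *)

(** The sign is chosen so that a traceless linear field [hat K] is the
    divergence of [pi_KF K F]. *)
Definition div {R : realType} (Q : bivector R) : vfield R :=
  \col_i \sum_j (Q j i)^`M(j).

Lemma ord3E (i : 'I_3) : [\/ i = ix, i = iy | i = iz].
Proof.
case: i => [[|[|[|i]]] lti] //.
- by apply: Or31; apply: val_inj.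
- by apply: Or32; apply: val_inj.
- by apply: Or33; apply: val_inj.
Qed.

Lemma antisym_mxE (R : realType) (Q : bivector R) i j :
  Q^T = - Q -> Q j i = - Q i j.
Proof.
by move=> QN; have := congr1 (fun M : bivector R => M i j) QN; rewrite !mxE.
Qed.

Lemma antisym_mx_diag (R : realType) (Q : bivector R) i : Q^T = - Q -> Q i i = 0.
Proof.
by move=> QN; apply: mpoly_double_eq0; rewrite mulr2n {1}(antisym_mxE _ _ QN) addNr.
Qed.

Lemma wedge_antisym (R : realType) (X Y : vfield R) : (wedge X Y)^T = - wedge X Y.
Proof. by apply/matrixP => i j; rewrite !mxE opprB. Qed.

Lemma pi_fun_antisym (R : realType) (g : {mpoly R[3]}) : (pi_fun g)^T = - pi_fun g.
Proof. by rewrite /pi_fun !linearD !linearZ /= !wedge_antisym !scalerN. Qed.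

Lemma pi_KF_antisym (R : realType) (K : 'M[R]_3) (F : {mpoly R[3]}) :
  (pi_KF K F)^T = - pi_KF K F.
Proof.
rewrite /pi_KF opprD -(pi_fun_antisym F) -scalerN -(wedge_antisym (hat 1%:M)).
by rewrite linearD linearZ.
Qed.

Lemma schouten_rot (R : realType) (P Q : bivector R) i j k :
  schouten P Q i j k = schouten P Q j k i.
Proof. by rewrite /schouten [RHS]addrC addrA. Qed.

Lemma schouten_swap (R : realType) (P Q : bivector R) i j k :
  P^T = - P -> Q^T = - Q -> schouten P Q i j k = - schouten P Q j i k.
Proof.
move=> PN QN; rewrite /schouten !sum3.
rewrite (antisym_mxE i j PN) (antisym_mxE i j QN) (antisym_mxE k i PN).
rewrite (antisym_mxE k i QN) (antisym_mxE j k PN) (antisym_mxE j k QN).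
rewrite !mderivN; ring.
Qed.

(** In dimension three an alternating trivector has one component. *)
Lemma schouten_eq0 (R : realType) (P Q : bivector R) :
  P^T = - P -> Q^T = - Q ->
  (forall i j k, schouten P Q i j k = 0) <-> schouten P Q ix iy iz = 0.
Proof.
move=> PN QN; split=> [-> // | S0].
have S i j k : schouten P Q i j k = - schouten P Q j i k by exact: schouten_swap.
have Siik i k : schouten P Q i i k = 0.
  by apply: mpoly_double_eq0; rewrite mulr2n {1}S addNr.
have Siji i j : schouten P Q i j i = 0 by rewrite -schouten_rot.
have Sjii i j : schouten P Q j i i = 0 by rewrite schouten_rot.
have Sxyz : [/\ schouten P Q iy iz ix = 0, schouten P Q iz ix iy = 0,
    schouten P Q iy ix iz = 0, schouten P Q ix iz iy = 0
    & schouten P Q iz iy ix = 0].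
  have S1 : schouten P Q iy iz ix = 0 by rewrite -schouten_rot.
  have S2 : schouten P Q iz ix iy = 0 by rewrite schouten_rot.
  by split; rewrite // S ?S0 ?S1 ?S2 oppr0.
case: Sxyz => Syzx Szxy Syxz Sxzy Szyx i j k.
by case: (ord3E i) => ->; case: (ord3E j) => ->; case: (ord3E k) => ->.
Qed.

Lemma pi_funE (R : realType) (g : {mpoly R[3]}) :
  (pi_fun g ix iy = g^`M(iz)) * (pi_fun g iy iz = g^`M(ix))
  * (pi_fun g iz ix = g^`M(iy)).
Proof.
by rewrite !mxE /= !(mulr1, mulr0, mul0r, subr0, sub0r, oppr0, addr0, add0r).
Qed.

Lemma div_pi_fun (R : realType) (g : {mpoly R[3]}) : div (pi_fun g) = 0.
Proof.
have gN := pi_fun_antisym g.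
apply/colP => i; case: (ord3E i) => ->; rewrite !mxE sum3 antisym_mx_diag //.
- rewrite (antisym_mxE ix iy gN) !pi_funE mderivN mderiv0.
  by rewrite (mderiv_comm iz iy) add0r addNr.
- rewrite (antisym_mxE iy iz gN) !pi_funE mderivN mderiv0.
  by rewrite (mderiv_comm ix iz) addr0 subrr.
rewrite (antisym_mxE iz ix gN) !pi_funE mderivN mderiv0.
by rewrite (mderiv_comm iy ix) addr0 addNr.
Qed.

(** The terms that differentiate [Q] assemble into its divergence; those that
    differentiate [pi_fun g] pair the Hessian of [g], a symmetric matrix, with
    the antisymmetric [Q], and cancel. *)
Lemma schouten_pi_fun (R : realType) (g : {mpoly R[3]}) (Q : bivector R) :
  Q^T = - Q -> schouten (pi_fun g) Q ix iy iz = vf_app (div Q) g.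
Proof.
move=> QN; have gN := pi_fun_antisym g.
rewrite /schouten /vf_app !sum3 ![div Q _ _]mxE !sum3 !(antisym_mx_diag _ gN).
rewrite !(antisym_mx_diag _ QN) (antisym_mxE ix iy gN) (antisym_mxE iy iz gN).
rewrite (antisym_mxE iz ix gN) (antisym_mxE ix iy QN) (antisym_mxE iy iz QN).
rewrite (antisym_mxE iz ix QN) !pi_funE !mderivN !mderiv0.
rewrite (mderiv_comm iy ix) (mderiv_comm iz ix) (mderiv_comm iz iy).
ring.
Qed.

Lemma mderiv_hat (R : realType) (K : 'M[R]_3) i l :
  (hat K i 0)^`M(l) = (K i l)%:MP.
Proof.
rewrite mxE raddf_sum /= (bigD1 l) //= big1 ?addr0.
  by rewrite mderiv_mulC mderivXU eqxx mulr1.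
by move=> j jl; rewrite mderiv_mulC mderivXU (negPf jl) mulr0.
Qed.

Lemma hat1E (R : realType) i : hat (1%:M : 'M[R]_3) i 0 = 'X_i.
Proof.
rewrite mxE (bigD1 i) //= big1 ?addr0; first by rewrite mxE eqxx mpolyC1 mul1r.
by move=> j ji; rewrite mxE eq_sym (negPf ji) mpolyC0 mul0r.
Qed.

Lemma div_wedge_hat (R : realType) (K : 'M[R]_3) :
  div (wedge (hat 1%:M) (hat K)) =
    hat K *+ 3 - (\tr K)%:MP *: hat 1%:M.
Proof.
have hatE i : hat K i 0 = (K i ix)%:MP * 'X_ix + (K i iy)%:MP * 'X_iy
    + (K i iz)%:MP * 'X_iz by rewrite mxE sum3.
have divE i : div (wedge (hat 1%:M) (hat K)) i 0 = \sum_j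
    ((j == j)%:R * hat K i 0 + 'X_j * (K i j)%:MP
     - ((i == j)%:R * hat K j 0 + 'X_i * (K j j)%:MP)).
  rewrite [LHS]mxE; apply: eq_bigr => j _.
  by rewrite [wedge _ _ _ _]mxE !hat1E mderivB !mderivM !mderivXU !mderiv_hat.
have subE (X Y : vfield R) c i : (X *+ 3 - c *: Y) i 0 = X i 0 *+ 3 - c * Y i 0.
  by rewrite !(mxE, mulmxnE).
apply/colP => i; rewrite subE divE sum3 hat1E /mxtrace sum3 !mpolyCD !hatE.
by case: (ord3E i) => -> /=; ring.
Qed.

Lemma divD (R : realType) (P Q : bivector R) : div (P + Q) = div P + div Q.
Proof.
apply/colP => i; rewrite !mxE -big_split.
by apply: eq_bigr => j _; rewrite mxE mderivD.
Qed.

Lemma divZ (R : realType) (c : R) (Q : bivector R) :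
  div (c%:MP *: Q) = c%:MP *: div Q.
Proof.
apply/colP => i; rewrite !mxE mulr_sumr.
by apply: eq_bigr => j _; rewrite mxE mderiv_mulC.
Qed.

Lemma div_pi_KF (R : realType) (K : 'M[R]_3) (F : {mpoly R[3]}) :
  in_sl3 K -> div (pi_KF K F) = hat K.
Proof.
rewrite /in_sl3 => trK; rewrite divD divZ div_pi_fun div_wedge_hat trK mpolyC0.
rewrite scale0r subr0 addr0 -scaler_nat scalerA -mpolyC_nat -mpolyCM.
by rewrite mulVf ?pnatr_eq0 // mpolyC1 scale1r.
Qed.

Lemma quadratic_deformationE (R : realType) (f F : {mpoly R[3]}) (K : 'M[R]_3) :
  quadratic_deformation f K F <-> [/\ in_sl3 K, in_o f K & cubic_invariant K F].
Proof.
rewrite /in_o; split=> [[trK KF S0] | [trK Kf KF]]; split=> //.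
  by rewrite -(div_pi_KF F trK) -(schouten_pi_fun _ (pi_KF_antisym K F)).
apply/(schouten_eq0 (pi_fun_antisym _) (pi_KF_antisym _ _)).
by rewrite (schouten_pi_fun _ (pi_KF_antisym K F)) div_pi_KF.
Qed.

(** * Linear fields preserving a diagonal quadratic form *)

Lemma in_o_diag (R : realType) (a b c : R) (K : 'M[R]_3) :
  in_o (a *: cx ^+ 2 + b *: cy ^+ 2 + c *: cz ^+ 2) K <->
  [/\ a * K ix ix = 0, b * K iy iy = 0 & c * K iz iz = 0] /\
  [/\ a * K ix iy + b * K iy ix = 0, b * K iy iz + c * K iz iy = 0
    & c * K iz ix + a * K ix iz = 0].
Proof.
pose d (i : 'I_3) := [:: a; b; c]`_i.
have -> : a *: cx ^+ 2 + b *: cy ^+ 2 + c *: cz ^+ 2 =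
    \sum_i d i *: ('X_i : {mpoly R[3]}) ^+ 2 by rewrite sum3.
rewrite in_oE; set M := _ + _.
have ME i j : M i j = d j * K j i + d i * K i j.
  by rewrite /M mul_diag_mx mul_mx_diag !mxE mulrC.
split=> [M0 | [[Kxx Kyy Kzz] [Kxy Kyz Kzx]]].
  have E i j : d j * K j i + d i * K i j = 0 by rewrite -ME M0 mxE.
  have E2 i : d i * K i i = 0.
    by have /eqP := E i i; rewrite -mulr2n mulrn_eq0 => /eqP.
  split; split; [exact: (E2 ix) | exact: (E2 iy) | exact: (E2 iz) | | |].
  - exact: (E iy ix).
  - exact: (E iz iy).
  - exact: (E ix iz).
apply/matrixP => i j; rewrite ME mxE.
case: (ord3E i) => ->; case: (ord3E j) => ->; rewrite /d /=.
all: rewrite ?Kxx ?Kyy ?Kzz ?addr0 //; by rewrite addrC.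
Qed.

(** * The six normal forms *)

Lemma mx3E (R : realType) (a b c d e f g h k : R) (K : 'M[R]_3) :
  K = mx3 [:: [:: a; b; c]; [:: d; e; f]; [:: g; h; k]] <->
  [/\ K ix ix = a, K ix iy = b & K ix iz = c] /\
  [/\ K iy ix = d, K iy iy = e & K iy iz = f] /\
  [/\ K iz ix = g, K iz iy = h & K iz iz = k].
Proof.
split=> [-> | [[? ? ?] [[? ? ?] [? ? ?]]]]; first by rewrite !mxE.
by apply/matrixP => i j; case: (ord3E i) => ->; case: (ord3E j) => ->; rewrite mxE.
Qed.

Lemma in_sl3E (R : realType) (K : 'M[R]_3) :
  in_sl3 K <-> K ix ix + K iy iy + K iz iz = 0.
Proof. by rewrite /in_sl3 /mxtrace sum3. Qed.

Theorem theorem4p1 (R : realType) :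
  (forall (K : 'M[R]_3) (F : {mpoly R[3]}),
     quadratic_deformation 0 K F <->
       in_sl3 K /\ cubic_invariant K F) /\
  (forall (K : 'M[R]_3) (F : {mpoly R[3]}),
     quadratic_deformation (cx ^+ 2 + cy ^+ 2 + cz ^+ 2) K F <->
       in_o3 K /\ cubic_invariant K F) /\
  (forall (K : 'M[R]_3) (F : {mpoly R[3]}),
     quadratic_deformation (cx ^+ 2 + cy ^+ 2 - cz ^+ 2) K F <->
       in_o21 K /\ cubic_invariant K F) /\
  (forall (K : 'M[R]_3) (F : {mpoly R[3]}),
     quadratic_deformation (cx ^+ 2 + cy ^+ 2) K F <->
       (exists alpha beta gamma : R,
          K = mx3 [:: [:: 0; alpha; 0];
                      [:: - alpha; 0; 0];
                      [:: beta; gamma; 0]]) /\ cubic_invariant K F) /\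
  (forall (K : 'M[R]_3) (F : {mpoly R[3]}),
     quadratic_deformation (cx ^+ 2 - cy ^+ 2) K F <->
       (exists alpha beta gamma : R,
          K = mx3 [:: [:: 0; alpha; 0];
                      [:: alpha; 0; 0];
                      [:: beta; gamma; 0]]) /\ cubic_invariant K F) /\
  (forall (K : 'M[R]_3) (F : {mpoly R[3]}),
     quadratic_deformation (cx ^+ 2) K F <->
       (exists alpha beta gamma delta theta : R,
          K = mx3 [:: [:: 0; 0; 0];
                      [:: alpha; delta; theta];
                      [:: beta; gamma; - delta]]) /\ cubic_invariant K F).
Proof.
have o0 (K : 'M[R]_3) : in_o 0 K.
  by rewrite /in_o /vf_app big1 // => i _; rewrite mderiv0 mulr0.
have so (q : {mpoly R[3]}) a b c K : a != 0 -> b != 0 -> c != 0 ->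
    q = a *: cx ^+ 2 + b *: cy ^+ 2 + c *: cz ^+ 2 -> in_o q K -> in_sl3 K.
  move=> a0 b0 c0 -> /in_o_diag[[/eqP Kxx /eqP Kyy /eqP Kzz] _]; apply/in_sl3E.
  move: Kxx Kyy Kzz; rewrite !mulf_eq0 (negPf a0) (negPf b0) (negPf c0) /=.
  by move=> /eqP-> /eqP-> /eqP->; rewrite !addr0.
have q2 : cx ^+ 2 + cy ^+ 2 + cz ^+ 2 =
    (1 : R) *: cx ^+ 2 + 1 *: cy ^+ 2 + 1 *: cz ^+ 2 by rewrite !scale1r.
have q3 : cx ^+ 2 + cy ^+ 2 - cz ^+ 2 =
    (1 : R) *: cx ^+ 2 + 1 *: cy ^+ 2 + (-1) *: cz ^+ 2.
  by rewrite !scale1r scaleN1r.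
have q4 : cx ^+ 2 + cy ^+ 2 = (1 : R) *: cx ^+ 2 + 1 *: cy ^+ 2 + 0 *: cz ^+ 2.
  by rewrite !scale1r scale0r addr0.
have q5 : cx ^+ 2 - cy ^+ 2 =
    (1 : R) *: cx ^+ 2 + (-1) *: cy ^+ 2 + 0 *: cz ^+ 2.
  by rewrite scale1r scaleN1r scale0r addr0.
have q6 : cx ^+ 2 = (1 : R) *: cx ^+ 2 + 0 *: cy ^+ 2 + 0 *: cz ^+ 2.
  by rewrite scale1r !scale0r !addr0.
have N1 : -1 != 0 :> R by rewrite oppr_eq0 oner_eq0.
have I1 := oner_neq0 R.
split; [|split; [|split; [|split; [|split]]]] => K F.
- by rewrite quadratic_deformationE; split=> [[] | []].
- rewrite quadratic_deformationE; split=> [[] | [oK]] //.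
  by split=> //; exact: (so _ _ _ _ _ I1 I1 I1 q2 oK).
- rewrite quadratic_deformationE; split=> [[] | [oK]] //.
  by split=> //; exact: (so _ _ _ _ _ I1 I1 N1 q3 oK).
- rewrite quadratic_deformationE q4.
  split=> [[/in_sl3E tr0 /in_o_diag] | [[a [b [c]]]]].
    rewrite !(mul1r, mul0r, addr0, add0r).
    move=> [[Kxx Kyy _] [/eqP + Kyz Kxz]] KF.
    rewrite addrC addr_eq0 => /eqP Kyx; split=> //.
    exists (K ix iy), (K iz ix), (K iz iy); apply/mx3E.
    by move: tr0; rewrite Kxx Kyy !add0r.
  move/mx3E=> [[Kxx Kxy Kxz] [[Kyx Kyy Kyz] [_ _ Kzz]]] KF; split=> //.
    by apply/in_sl3E; rewrite Kxx Kyy Kzz !addr0.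
  apply/in_o_diag; rewrite Kxx Kyy Kxy Kyx Kyz Kxz.
  by rewrite !(mul1r, mul0r, mulr0, addr0) subrr.
- rewrite quadratic_deformationE q5.
  split=> [[/in_sl3E tr0 /in_o_diag] | [[a [b [c]]]]].
    rewrite !(mul1r, mul0r, mulN1r, addr0, add0r).
    move=> [[Kxx /eqP + _] [/eqP + /eqP + Kxz]] KF.
    rewrite !oppr_eq0 subr_eq0 => /eqP Kyy /eqP Kxy /eqP Kyz; split=> //.
    exists (K ix iy), (K iz ix), (K iz iy); apply/mx3E.
    by move: tr0; rewrite Kxx Kyy !add0r.
  move/mx3E=> [[Kxx Kxy Kxz] [[Kyx Kyy Kyz] [_ _ Kzz]]] KF; split=> //.
    by apply/in_sl3E; rewrite Kxx Kyy Kzz !addr0.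
  apply/in_o_diag; rewrite Kxx Kyy Kxy Kyx Kyz Kxz.
  by rewrite !(mul1r, mul0r, mulr0, mulN1r, addr0) subrr.
- rewrite quadratic_deformationE q6.
  split=> [[/in_sl3E tr0 /in_o_diag] | [[a [b [c [d [e]]]]]]].
    rewrite !(mul1r, mul0r, addr0, add0r).
    move=> [[Kxx _ _] [Kxy _ Kxz]] KF; split=> //.
    exists (K iy ix), (K iz ix), (K iz iy), (K iy iy), (K iy iz); apply/mx3E.
    by move: tr0 => /eqP; rewrite Kxx add0r addrC addr_eq0 => /eqP.
  move/mx3E=> [[Kxx Kxy Kxz] [[_ Kyy _] [_ _ Kzz]]] KF; split=> //.
    by apply/in_sl3E; rewrite Kxx Kyy Kzz add0r subrr.
  by apply/in_o_diag; rewrite Kxx Kxy Kxz !(mul0r, mulr0, addr0).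
Qed.
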